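(* Let $n\ge 3$. For the Grassmannian ${\rm Gr}(3,n)$, the block diagonal matching field polytope $P_{\mathcal{B}_2}$ can be obtained from $P_{\mathcal{B}_1}$ by a sequence of combinatorial mutations.
   Context: For $k=3$: for each $3$-subset $I=\{i_1<i_2<i_3\}$ of $[n]$ a matching field assigns $\sigma=\Lambda(I)\in S_3$; its polytope $P_\Lambda\subset\mathbb{R}^{3\times n}$ is the convex hull of the vectors $\sum_{r=1}^3 e_{\sigma(r),i_r}$ ($e_{i,j}$ the standard basis matrices). For $0\le\ell\le n$, the block diagonal matching field $\mathcal{B}_\ell$ has $\mathcal{B}_\ell(I)=\mathrm{id}$ if $|I\cap\{1,\dots,\ell\}|\ne1$ and $(12)$ otherwise. Combinatorial mutation: with $N\cong\mathbb{Z}^d$, $M$ its dual, $w\in M$ primitive and $F\subset w^\perp\subset N_\mathbb{R}$ a lattice polytope, the tropical map is $\varphi_{w,F}(u)=u-(\min_{f\in F}\langle f,u\rangle)w$; if $P\subset M_\mathbb{R}$ is a lattice polytope containing the origin and $\varphi_{w,F}(P)$ is convex, it is a combinatorial mutation of $P$. A sequence of combinatorial mutations is a finite chain of polytopes in which consecutive polytopes are related, after identification via lattice-preserving affine isomorphisms (unimodular equivalences) of the lattices they span, either by a unimodular equivalence or by a combinatorial mutation. *)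

(* Defs.v *)
From HB Require Import structures.
From mathcomp Require Import all_boot all_order all_algebra all_fingroup.
From mathcomp Require Import reals Rstruct.
From Stdlib Require Import Rdefinitions.

Set Implicit Arguments.
Unset Strict Implicit.
Unset Printing Implicit Defensive.

Import Order.TTheory GRing.Theory Num.Theory.
Local Open Scope ring_scope.

Notation vec D := ('rV[R]_D).
Definition region D := vec D -> Prop.

Definition isZvec D (x : vec D) : Prop := forall i, x ord0 i \is a Num.int.

(* standard pairing between N_R = R^D and M_R = R^D (dual bases) *)
Definition pair D (f u : vec D) : R := \sum_(i < D) f ord0 i * u ord0 i.

Definition hull D (S : region D) : region D := fun x =>
  exists k (p : 'I_k -> vec D) (c : 'I_k -> R),
    [/\ forall i, S (p i), forall i, 0 <= c i, \sum_(i < k) c i = 1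
      & x = \sum_(i < k) c i *: p i].

Definition convex_set D (Q : region D) : Prop :=
  forall x y (t : R), Q x -> Q y -> 0 <= t -> t <= 1 -> Q (t *: x + (1 - t) *: y).

Definition lattice_polytope D (P : region D) : Prop :=
  exists V : seq (vec D), [/\ V <> [::], forall v, v \in V -> isZvec v
    & forall x, P x <-> hull (fun y => y \in V) x].

Definition primitive D (w : vec D) : Prop :=
  [/\ isZvec w, w != 0 &
   forall (k : R) (w' : vec D), k \is a Num.int -> isZvec w' -> w = k *: w' ->
     k = 1 \/ k = -1].

Definition is_min_pair D (F : region D) (u : vec D) (m : R) : Prop :=
  (exists f, F f /\ pair f u = m) /\ (forall f, F f -> m <= pair f u).

Definition comb_mutation D (P Q : region D) : Prop :=
  [/\ lattice_polytope P, P 0 &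
   exists (w : vec D) (F : region D),
     [/\ primitive w, lattice_polytope F, (forall f, F f -> pair f w = 0),
         (forall x, Q x <-> exists u m, [/\ P u, is_min_pair F u m & x = u - m *: w])
       & convex_set Q]].

Definition span_lattice D (P : region D) : region D := fun x =>
  exists k (p : 'I_k -> vec D) (z : 'I_k -> R),
    [/\ forall i, P (p i) /\ isZvec (p i), forall i, z i \is a Num.int,
        \sum_(i < k) z i = 1 & x = \sum_(i < k) z i *: p i].

Definition identified r D (P : region D) (P' : region r) : Prop :=
  exists (A : 'M[R]_(r, D)) (b : vec D),
    let iota := fun y : vec r => y *m A + b in
    [/\ injective iota,
        forall y, isZvec y -> span_lattice P (iota y),
        forall x, span_lattice P x -> exists2 y, isZvec y & iota y = x
      & forall y, P' y <-> P (iota y)].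

Definition unimod_equiv r (P Q : region r) : Prop :=
  exists (A : 'M[R]_r) (b : vec r),
    [/\ forall i j, A i j \is a Num.int, \det A = 1 \/ \det A = -1, isZvec b
      & forall y, Q y <-> exists2 x, P x & y = x *m A + b].

Definition mutation_step D D' (P : region D) (Q : region D') : Prop :=
  [/\ lattice_polytope P, lattice_polytope Q &
   exists r (P' Q' : region r),
     [/\ identified P P', identified Q Q' &
      [\/ unimod_equiv P' Q', comb_mutation P' Q' | comb_mutation Q' P']]].

Inductive mutation_seq : forall D D', region D -> region D' -> Prop :=
| mseq_refl D (P : region D) : mutation_seq P P
| mseq_step D D' D'' (P : region D) (Q : region D') (S : region D'') :
    mutation_step P Q -> mutation_seq Q S -> mutation_seq P S.

(* Matching fields for k = 3.  Indices are 0-based: [n] = 'I_n, rows 'I_3. *)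
Definition matching_field3 n := 'I_n -> 'I_n -> 'I_n -> 'S_3.

Definition mf_vertex n (s : 'S_3) (i1 i2 i3 : 'I_n) : 'M[R]_(3, n) :=
  \matrix_(a < 3, j < n)
    (((a == s 0) && (j == i1))%:R + ((a == s 1) && (j == i2))%:R
     + ((a == s 2) && (j == i3))%:R).

(* P_Lambda, with R^{3 x n} identified with R^{3n} via mxvec (a lattice iso) *)
Definition mf_polytope n (L : matching_field3 n) : region (3 * n) :=
  hull (fun x => exists i1 i2 i3 : 'I_n,
           [/\ ltn i1 i2, ltn i2 i3 & x = mxvec (mf_vertex (L i1 i2 i3) i1 i2 i3)]).

(* block diagonal matching field B_l: identity unless |I cap {1..l}| = 1,
   in which case the transposition (12) *)
Definition block_diag n (l : nat) : matching_field3 n := fun i1 i2 i3 =>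
  if (ltn i1 l + ltn i2 l + ltn i3 l == 1)%N
  then tperm (0 : 'I_3) 1 else 1%g.
Arguments block_diag : clear implicits.

(* Main.v *)
(* Exchanging the columns 1 and 2 turns B_1 into the field that transposes
   {2, i, j} but not {1, i, j} (2 < i < j), which differs from B_2 exactly at the
   sets {1, i, j} with 2 < i.  These are transposed one value m of i at a time.
   On vertices, step m adds w = e_{2,1} + e_{1,m} - e_{1,1} - e_{2,m} to the
   vertices of {1, m, j}.  There is an integral f orthogonal to w with value -1 on
   these vertices and 0 or 1 on all others, so that the step is the tropical map of
   the segment conv (0, f) on vertices.  It maps the whole polytope onto the next
   one because a vertex a at level -1 and a vertex b at level 1 can always be
   exchanged for two vertices at level 0 with the same sum, hence the parts f <= 0
   and f >= 0 of both polytopes are spanned by vertices.  The same exchanges show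
   that both polytopes span the same lattice, except at the first step, where f <= 0
   and the tropical map is a unimodular shear. *)

Require Import Defs.
From mathcomp Require Import all_boot all_order all_algebra all_fingroup.
From mathcomp Require Import reals Rstruct zify ring lra boolp.
Local Notation R := Rdefinitions.R.
Import Order.TTheory GRing.Theory Num.Theory.

Set Implicit Arguments.
Unset Strict Implicit.
Unset Printing Implicit Defensive.

Local Open Scope ring_scope.

(** * Combinations with coefficients in a subsemiring of the reals *)

(** Nonnegative coefficients of total [t = 1] give convex hulls, integer ones give integer affine
    spans. Leaving the total free makes combinations closed under sums and scaling. *)
Definition comb (K : {pred R}) D (S : region D) (t : R) (x : vec D) : Prop :=
  exists k (p : 'I_k -> vec D) (c : 'I_k -> R),
    [/\ forall i, S (p i), forall i, c i \in K, \sum_(i < k) c i = t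
      & x = \sum_(i < k) c i *: p i].

Section Combinations.
Variables (K : semiringClosed R) (D : nat).
Implicit Types (S : region D) (x y : vec D) (s t : R).

Lemma comb0 S : comb K S 0 0.
Proof.
exists 0%N, (fun=> 0), (fun=> 0); split; rewrite ?big_ord0 //; by case.
Qed.

Lemma combD S s t x y : comb K S s x -> comb K S t y -> comb K S (s + t) (x + y).
Proof.
move=> [k [p [c [Sp Kc <- ->]]]] [l [q [d [Sq Kd <- ->]]]].
exists (k + l)%N.
exists (fun i => match split i with inl a => p a | inr b => q b end).
exists (fun i => match split i with inl a => c a | inr b => d b end).
split=> [i|i||].
- by case: (split i).
- by case: (split i).
- rewrite big_split_ord /=.
  by congr (_ + _); apply: eq_bigr => i _; rewrite ?(unsplitK (inl i)) ?(unsplitK (inr i)).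
- rewrite big_split_ord /=.
  by congr (_ + _); apply: eq_bigr => i _; rewrite ?(unsplitK (inl i)) ?(unsplitK (inr i)).
Qed.

Lemma combZ S a t x : a \in K -> comb K S t x -> comb K S (a * t) (a *: x).
Proof.
move=> Ka [k [p [c [Sp Kc <- ->]]]]; exists k, p, (fun i => a * c i); split=> //.
- by move=> i; rewrite rpredM.
- by rewrite mulr_sumr.
- by rewrite scaler_sumr; apply: eq_bigr => i _; rewrite scalerA.
Qed.

Lemma comb_mem S x : S x -> comb K S 1 x.
Proof.
move=> Sx; exists 1%N, (fun=> x), (fun=> 1); split=> //.
- by move=> i; rewrite rpred1.
- by rewrite big_ord1.
- by rewrite big_ord1 scale1r.
Qed.

Lemma comb_sum (I : finType) (P : pred I) S (t : I -> R) (x : I -> vec D) :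
  (forall i, P i -> comb K S (t i) (x i)) ->
  comb K S (\sum_(i | P i) t i) (\sum_(i | P i) x i).
Proof.
move=> Sx; apply: (big_ind2 (comb K S)) => //; first exact: comb0.
by move=> ? ? ? ?; apply: combD.
Qed.

Lemma comb_sub S S' t x :
  (forall y, S y -> comb K S' 1 y) -> comb K S t x -> comb K S' t x.
Proof.
move=> SS' [k [p [c [Sp Kc <- ->]]]]; apply: comb_sum => i _.
by rewrite -[X in comb _ _ X]mulr1; apply: combZ (SS' _ (Sp i)).
Qed.

End Combinations.

(** * Hulls of 0/1-vectors and the lattices they span *)

Lemma hullE D (S : region D) x : hull S x <-> comb Num.Def.nneg_num_pred S 1 x.
Proof. by split. Qed.

Definition polytope D (V : seq (vec D)) : region D := hull (fun y => y \in V).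

Definition zspan D (V : seq (vec D)) : region D :=
  comb Num.int_num_subdef (fun y => y \in V) 1.

Definition zero_one D (V : seq (vec D)) : Prop :=
  forall v, v \in V -> forall i, v ord0 i = 0 \/ v ord0 i = 1.

Lemma hull_mem D (S : region D) x : S x -> hull S x.
Proof. by move=> Sx; apply/hullE; apply: comb_mem. Qed.

Lemma hull_sub D (S S' : region D) x :
  (forall y, S y -> hull S' y) -> hull S x -> hull S' x.
Proof. by move=> SS' /hullE Sx; apply/hullE; apply: comb_sub Sx => y /SS'. Qed.

Lemma hull_convex D (S : region D) : convex_set (hull S).
Proof.
move=> x y t /hullE Sx /hullE Sy t0 t1; apply/hullE.
rewrite -[X in comb _ _ X](subrK t); rewrite addrC -[X in X + _]mulr1 -[X in _ + X]mulr1.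
by apply: combD; apply: combZ => //; rewrite -?topredE /= ?subr_ge0.
Qed.

Lemma zero_one_int D (V : seq (vec D)) : zero_one V -> forall v, v \in V -> isZvec v.
Proof. by move=> V01 v Vv i; case: (V01 v Vv i) => ->; rewrite ?rpred0 ?rpred1. Qed.

Lemma zero_one_lattice D (V : seq (vec D)) : V <> [::] -> zero_one V ->
  lattice_polytope (polytope V).
Proof. by move=> V0 V01; exists V; split=> //; apply: zero_one_int. Qed.

(* At a lattice point of a 0/1-polytope every coordinate is extremal, so any
   vertex occurring with positive weight agrees with it everywhere. *)
Lemma zero_one_lattice_points D (V : seq (vec D)) x : zero_one V ->
  polytope V x -> isZvec x -> x \in V.
Proof.
move=> V01 [k [p [c [Vp c0 c1 xE]]]] xZ.
have [i0 ci0] : exists i0, c i0 != 0.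
  apply/existsP; rewrite -negb_forall; apply/negP => /forallP call.
  have := oner_neq0 R; rewrite -c1 big1 ?eqxx // => i _; exact/eqP.
suff -> : x = p i0 by [].
apply/rowP => l.
have p01 i : 0 <= p i ord0 l <= 1.
  by case: (V01 _ (Vp i) l) => ->; rewrite lexx ler01.
have xl : x ord0 l = \sum_(i < k) c i * p i ord0 l.
  by rewrite xE summxE; apply: eq_bigr => i _; rewrite mxE.
have xl' : 1 - x ord0 l = \sum_(i < k) c i * (1 - p i ord0 l).
  rewrite xl -[X in X - _]c1 -sumrB; apply: eq_bigr => i _; by rewrite mulrBr mulr1.
have x0 : 0 <= x ord0 l.
  by rewrite xl sumr_ge0 // => i _; case/andP: (p01 i) => ? _; rewrite mulr_ge0.
have x1 : 0 <= 1 - x ord0 l.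
  by rewrite xl' sumr_ge0 // => i _; case/andP: (p01 i) => _ ?; rewrite mulr_ge0 ?subr_ge0.
have /orP[/eqP x00|/eqP x11] : (x ord0 l == 0) || (x ord0 l == 1).
  case/intrP: (xZ l) x0 x1 => z ->; rewrite subr_ge0 ler0z -[1]/(1%:~R) ler_int => z0 z1.
  rewrite eqr_int -[0]/(0%:~R) eqr_int; lia.
- have H i : true -> 0 <= c i * p i ord0 l by case/andP: (p01 i) => ? _ _; rewrite mulr_ge0.
  have := psumr_eq0P (P := predT) (fun i h => H i h); rewrite -xl => /(_ x00 i0 isT) /eqP.
  by rewrite mulf_eq0 (negPf ci0) /= => /eqP ->.
- have H i : true -> 0 <= c i * (1 - p i ord0 l).
    by case/andP: (p01 i) => _ ? _; rewrite mulr_ge0 ?subr_ge0.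
  have := psumr_eq0P (P := predT) (fun i h => H i h); rewrite -xl' x11 subrr.
  move=> /(_ erefl i0 isT) /eqP.
  by rewrite mulf_eq0 (negPf ci0) /= subr_eq0 => /eqP <-.
Qed.

(** [span_lattice] is generated by all lattice points of the polytope; here these are just the
    listed vectors, so the lattice has a finite generating list. *)
Lemma span_lattice_zero_one D (V : seq (vec D)) x : zero_one V ->
  span_lattice (polytope V) x <-> zspan V x.
Proof.
move=> V01; split=> [[k [p [c [Vp cZ c1 xE]]]]|[k [p [c [Vp cZ c1 xE]]]]].
  exists k, p, c; split=> // i; case: (Vp i) => ? ?; exact: zero_one_lattice_points.
exists k, p, c; split=> // i; split; first exact: hull_mem.
exact: zero_one_int (Vp i).
Qed.


(** * Lattice coordinates from the Smith normal form *)

Section Smith.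
Variables (k D : nat) (M : 'M[int]_(k, D)).

(* By the Smith normal form, the integer row span of [M] is spanned by the rows
   [d_i R_i] with [d_i != 0], which are linearly independent. *)
Lemma row_lattice_basis : exists r (A : 'M[int]_(r, D)),
  [/\ injective (fun y : 'rV[R]_r => y *m map_mx intr A),
      forall y : 'rV[int]_r, exists z : 'rV[int]_k, y *m A = z *m M
    & forall z : 'rV[int]_k, exists y : 'rV[int]_r, y *m A = z *m M].
Proof.
have [L uL [U uU [d _ ->]]] := int_Smith_normal_form M.
set Dg := \matrix_(i, j) _.
(* The positions of the nonzero diagonal entries; [A] keeps only these rows, whence its
   injectivity. *)
pose J := [set j : 'I_D | (j < k)%N && (d`_j != 0)].
pose A := \matrix_(a < #|J|, j < D) (d`_(enum_val a) *+ (enum_val a == j)).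
have AE (y : 'rV[int]_#|J|) (a : 'I_#|J|) : (y *m A) ord0 (enum_val a) = y ord0 a * d`_(enum_val a).
  rewrite mxE (bigD1 a) //= mxE eqxx big1 ?addr0 // => b bNa.
  by rewrite mxE (inj_eq enum_val_inj) (negPf bNa) mulr0n mulr0.
have AE0 (y : 'rV[int]_#|J|) j : j \notin J -> (y *m A) ord0 j = 0.
  move=> jJ; rewrite mxE big1 // => b _; rewrite mxE; case: eqP => [e|]; last by rewrite mulr0.
  by rewrite -e enum_valP in jJ.
have DE (z : 'rV[int]_k) (j : 'I_D) (h : (j < k)%N) : (z *m Dg) ord0 j = z ord0 (Ordinal h) * d`_j.
  rewrite mxE (bigD1 (Ordinal h)) //= mxE eqxx big1 ?addr0 // => b bNa.
  rewrite mxE; case: eqP => [e|]; rewrite ?mulr0 //.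
  by case/eqP: bNa; apply: val_inj.
have DE0 (z : 'rV[int]_k) (j : 'I_D) : j \notin J -> (z *m Dg) ord0 j = 0.
  move=> jJ; case: (ltnP j k) => h.
    rewrite DE; move: jJ; rewrite inE h /= negbK => /eqP ->; by rewrite mulr0.
  rewrite mxE big1 // => b _; rewrite mxE; case: eqP => [e|]; rewrite ?mulr0 //.
  by have := ltn_ord b; rewrite e ltnNge h.
exists #|J|, (A *m U); split.
- move=> x y /(congr1 (fun u => u *m map_mx intr (invmx U))).
  rewrite -!mulmxA -!map_mxM /= mulmxK // => /rowP e; apply/rowP => a.
  have := e (enum_val a).
  rewrite !mxE (bigD1 a) //= [in RHS](bigD1 a) //= !mxE eqxx.
  rewrite big1 ?[in RHS]big1 ?addr0; first 1 last.
  + by move=> b bNa; rewrite !mxE (inj_eq enum_val_inj) (negPf bNa) mulr0n mulr0.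
  + by move=> b bNa; rewrite !mxE (inj_eq enum_val_inj) (negPf bNa) mulr0n mulr0.
  apply: mulIf; rewrite intr_eq0.
  by have := enum_valP a; rewrite inE => /andP[].
(* Since [L] is unimodular, the coefficients after multiplication by [L] can be prescribed: [y] on
   [J] and 0 elsewhere. *)
- move=> y; pose z := \row_(i < k) \sum_(a < #|J| | nat_of_ord (enum_val a) == i) y ord0 a.
  exists (z *m invmx L); rewrite !mulmxA mulmxKV //; congr (_ *m U).
  apply/rowP => j; case: (boolP (j \in J)) => jJ; last by rewrite AE0 ?DE0.
  have jk : (j < k)%N by move: jJ; rewrite inE => /andP[].
  have ja : enum_val (enum_rank_in jJ j) = j by rewrite enum_rankK_in.
  rewrite DE; have := AE y (enum_rank_in jJ j); rewrite ja => ->; congr (_ * _).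
  rewrite mxE (big_pred1 (enum_rank_in jJ j)) // => a /=.
  by rewrite val_eqE -{1}ja (inj_eq enum_val_inj).
- move=> z; pose zL := z *m L.
  pose y := \row_(a < #|J|) \sum_(i < k | nat_of_ord i == enum_val a) zL ord0 i.
  exists y; rewrite !mulmxA; congr (_ *m U).
  apply/rowP => j; case: (boolP (j \in J)) => jJ; last by rewrite AE0 ?DE0.
  have jk : (j < k)%N by move: jJ; rewrite inE => /andP[].
  have ja : enum_val (enum_rank_in jJ j) = j by rewrite enum_rankK_in.
  rewrite -/zL DE; have := AE y (enum_rank_in jJ j); rewrite ja => ->; congr (_ * _).
  by rewrite mxE ja (big_pred1 (Ordinal jk)) // => a /=; rewrite -val_eqE.
Qed.

End Smith.

Lemma comb_affine_image (K : semiringClosed R) D D' (S : region D) (S' : region D')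
    (A : 'M[R]_(D, D')) b t y :
  (forall z, S' z <-> exists2 x, S x & z = x *m A + b) ->
  comb K S' t y <-> exists2 x, comb K S t x & y = x *m A + t *: b.
Proof.
move=> S'E; split=> [[k [p [c [Sp Kc ct ->]]]]|[x [k [p [c [Sp Kc ct ->]]]] ->]].
  have /fin_all_exists[q qP] : forall i, exists x, S x /\ p i = x *m A + b.
    by move=> i; have [x] := (S'E (p i)).1 (Sp i); exists x.
  exists (\sum_(i < k) c i *: q i).
    by exists k, q, c; split=> // i; case: (qP i).
  rewrite -ct mulmx_suml scaler_suml -big_split; apply: eq_bigr => i _ /=.
  by case: (qP i) => _ ->; rewrite scalerDr scalemxAl.
exists k, (fun i => p i *m A + b), c; split=> //.
  by move=> i; apply/S'E; exists (p i).
rewrite -ct mulmx_suml scaler_suml -big_split; apply: eq_bigr => i _ /=.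
by rewrite scalerDr scalemxAl.
Qed.

Lemma comb_intB D (S : region D) s t x y :
  comb Num.int_num_subdef S s x -> comb Num.int_num_subdef S t y ->
  comb Num.int_num_subdef S (s - t) (x - y).
Proof.
move=> Sx Sy; rewrite -[- y]scaleN1r -[- t]mulN1r; apply: combD => //.
by apply: combZ => //; rewrite rpredN1.
Qed.

Lemma zspan_mem D (V : seq (vec D)) x : x \in V -> zspan V x.
Proof. exact: comb_mem. Qed.

Lemma zspan_mono D (V W : seq (vec D)) x :
  (forall y, y \in V -> zspan W y) -> zspan V x -> zspan W x.
Proof. by move=> VW; apply: comb_sub. Qed.

Lemma zspan_parallelogram D (V : seq (vec D)) x y z :
  zspan V x -> zspan V y -> zspan V z -> zspan V (x + y - z).
Proof.
move=> Vx Vy Vz; rewrite /zspan -[X in comb _ _ X](addrK (1 : R)).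
by apply: comb_intB Vz; apply: combD.
Qed.

Lemma isZvec_map D (z : 'rV[int]_D) : isZvec (map_mx intr z).
Proof. by move=> i; rewrite mxE intr_int. Qed.

Lemma isZvecP D (x : vec D) : isZvec x -> exists z : 'rV[int]_D, x = map_mx intr z.
Proof.
move=> xZ; exists (map_mx Num.floor x); apply/rowP => i.
by rewrite !mxE floorK.
Qed.

(** The differences [v - p0] generate the translation lattice, and the rows of [A] form a basis of
    it. The coordinate map [g] is meaningful only on the span. *)
Lemma zspan_chart D (V : seq (vec D)) (p0 : vec D) :
  (forall v, v \in V -> isZvec v) -> p0 \in V ->
  exists r (A : 'M[R]_(r, D)) (g : vec D -> vec r),
  [/\ injective (fun y : vec r => y *m A), forall y, isZvec y -> zspan V (y *m A + p0),
      forall x, zspan V x -> isZvec (g x)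
    & forall x, zspan V x -> g x *m A + p0 = x].
Proof.
move=> VZ Vp0; pose k := size V.
pose M : 'M[int]_(k, D) := \matrix_(i < k, j < D) Num.floor ((V`_i - p0) ord0 j).
have rowM i : map_mx intr (row i M) = V`_i - p0.
  apply/rowP => j; rewrite !mxE floorK // rpredB //; apply: VZ => //.
  by rewrite mem_nth.
have [r [A [Ainj AM MA]]] := row_lattice_basis M.
have zM (z : 'rV[int]_k) : map_mx intr (z *m M) = \sum_(i < k) (z ord0 i)%:~R *: (V`_i - p0).
  rewrite mulmx_sum_row map_mx_sum; apply: eq_bigr => i _.
  by rewrite map_mxZ rowM.
have fwd (z : 'rV[int]_k) : zspan V (map_mx intr (z *m M) + p0).
  rewrite zM addrC /zspan.
  (* The point [p0] carries the whole weight; each difference has weight [1 - 1]. *)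
  have wE : 1 = 1 + \sum_(i < k) (z ord0 i)%:~R * (1 - 1) :> R.
    by rewrite subrr big1 ?addr0 // => i _; rewrite mulr0.
  rewrite [X in comb _ _ X]wE.
  apply: combD; first exact: comb_mem.
  apply: comb_sum => i _; apply: combZ; first exact: intr_int.
  by apply: comb_intB; apply: comb_mem => //; rewrite mem_nth.
have bwd x : zspan V x -> exists z : 'rV[int]_k, x = map_mx intr (z *m M) + p0.
  case=> l [p [c [Vp cZ c1 ->]]].
  have cE i : c i = (Num.floor (c i))%:~R by rewrite floorK // cZ.
  (* [V] may contain repetitions, so [q i] selects the first occurrence of [p i]. *)
  pose q i : 'rV[int]_k := \row_(j < k) (j == index (p i) V :> nat)%:R.
  have qE i : p i = map_mx intr (q i *m M) + p0.
    have h : (index (p i) V < k)%N by rewrite index_mem.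
    rewrite zM (bigD1 (Ordinal h)) //= mxE eqxx scale1r big1 ?addr0.
      by rewrite nth_index // subrK.
    move=> j; rewrite -val_eqE /= mxE => /negPf ->; exact: scale0r.
  exists (\sum_i Num.floor (c i) *: q i).
  rewrite mulmx_suml map_mx_sum -[p0 in RHS]scale1r -[X in X *: p0]c1 scaler_suml -big_split /=.
  apply: eq_bigr => i _; rewrite -scalemxAl map_mxZ {1}qE [in RHS]/= -cE.
  by rewrite scalerDr.
have /choice[g gP] : forall x, exists y : vec r, zspan V x ->
    isZvec y /\ y *m map_mx intr A + p0 = x.
  move=> x; have [/bwd[z ->]|nVx] := pselect (zspan V x); last by exists 0.
  have [y <-] := MA z; exists (map_mx intr y) => _; split; first exact: isZvec_map.
  by rewrite map_mxM.
exists r, (map_mx intr A), g; split=> //.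
- move=> y /isZvecP[z ->]; rewrite -map_mxM; have [u ->] := AM z; exact: fwd.
- by move=> x /gP[].
- by move=> x /gP[].
Qed.

Lemma affine_injective r D (A : 'M[R]_(r, D)) (b : vec D) :
  injective (fun y : vec r => y *m A) -> injective (fun y : vec r => y *m A + b).
Proof. by move=> Ainj x y /addIr /Ainj. Qed.

(** * Steps induced by injective linear maps *)

Lemma zspan_linear_image D (V W : seq (vec D)) (G : 'M[R]_D) y :
  (forall z, z \in W <-> exists2 x, x \in V & z = x *m G) ->
  zspan W y <-> exists2 x, zspan V x & y = x *m G.
Proof.
move=> WE; rewrite /zspan (@comb_affine_image _ _ _ (fun y => y \in V) _ G 0).
  by split=> -[x Vx ->]; exists x; rewrite ?scaler0 ?addr0.
by move=> z; split=> [/WE[x Vx ->]|[x Vx ->]]; [exists x|apply/WE; exists x]; rewrite ?addr0.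
Qed.

Lemma polytope_linear_image D (V W : seq (vec D)) (G : 'M[R]_D) y :
  (forall z, z \in W <-> exists2 x, x \in V & z = x *m G) ->
  polytope W y <-> exists2 x, polytope V x & y = x *m G.
Proof.
move=> WE; rewrite /polytope hullE (@comb_affine_image _ _ _ (fun y => y \in V) _ G 0).
  by split=> -[x Vx ->]; exists x; rewrite ?scaler0 ?addr0.
by move=> z; split=> [/WE[x Vx ->]|[x Vx ->]]; [exists x|apply/WE; exists x]; rewrite ?addr0.
Qed.

(* Only injectivity of [G] is required: the two spanned lattices are identified
   with the same standard lattice through charts that differ by [G]. *)
Lemma linear_step D (V W : seq (vec D)) (G : 'M[R]_D) :
  V <> [::] -> zero_one V -> zero_one W -> injective (fun x : vec D => x *m G) ->
  (forall z, z \in W <-> exists2 x, x \in V & z = x *m G) ->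
  mutation_step (polytope V) (polytope W).
Proof.
move=> V0 V01 W01 Ginj WE.
have [p0 Vp0] : exists p0, p0 \in V.
  by case: V V0 {V01 WE} => // v V _; exists v; rewrite mem_head.
have W0 : W <> [::].
  move=> W0; have : p0 *m G \in W by apply/WE; exists p0.
  by rewrite W0.
have [r [A [g [Ainj AZ gZ gK]]]] := zspan_chart (zero_one_int V01) Vp0.
split; try exact: zero_one_lattice.
exists r, (fun y => polytope V (y *m A + p0)), (fun y => polytope V (y *m A + p0)); split.
- exists A, p0; split=> //; first exact: affine_injective.
    by move=> y yZ; apply/span_lattice_zero_one => //; apply: AZ.
  move=> x /(span_lattice_zero_one _ V01) Vx; exists (g x); [exact: gZ|exact: gK].
- have EG y : y *m (A *m G) + p0 *m G = (y *m A + p0) *m G by rewrite mulmxDl mulmxA.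
  exists (A *m G), (p0 *m G); split.
  + by move=> x y; rewrite !EG => /Ginj /(affine_injective Ainj).
  + move=> y /AZ Vy; apply/span_lattice_zero_one => //.
    by apply/(zspan_linear_image _ WE); exists (y *m A + p0); rewrite ?EG.
  + move=> x /(span_lattice_zero_one _ W01) /(zspan_linear_image _ WE)[u Vu ->].
    by exists (g u); [exact: gZ|rewrite EG gK].
  + move=> y; rewrite EG (polytope_linear_image _ WE); split=> [Vy|]; first by exists (y *m A + p0).
    by case=> x Vx /Ginj ->.
- constructor 1; exists 1%:M, 0; split.
  + by move=> i j; rewrite mxE; case: eqP => _; rewrite ?rpred0 ?rpred1.
  + by left; rewrite det1.
  + by move=> i; rewrite mxE rpred0.
  + move=> y; split=> [Py|[x Px ->]]; last by rewrite mulmx1 addr0.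
    by exists y; rewrite // mulmx1 addr0.
Qed.

(** * The pairing, shears and the tropical map of a segment *)

Lemma pairE D (f u : vec D) : u *m f^T = (pair f u)%:M.
Proof.
apply/rowP => i; rewrite !mxE ord1 eqxx mulr1n; apply: eq_bigr => j _.
by rewrite !mxE mulrC.
Qed.

Lemma pairC D (f u : vec D) : pair f u = pair u f.
Proof. by apply: eq_bigr => i _; rewrite mulrC. Qed.

Lemma pairDr D (f u v : vec D) : pair f (u + v) = pair f u + pair f v.
Proof. by rewrite /pair -big_split; apply: eq_bigr => i _; rewrite mxE mulrDr. Qed.

Lemma pairZr D a (f u : vec D) : pair f (a *: u) = a * pair f u.
Proof. by rewrite /pair mulr_sumr; apply: eq_bigr => i _; rewrite mxE mulrCA. Qed.

Lemma pairNr D (f u : vec D) : pair f (- u) = - pair f u.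
Proof. by rewrite -scaleN1r pairZr mulN1r. Qed.

Lemma pairNl D (f u : vec D) : pair (- f) u = - pair f u.
Proof. by rewrite pairC pairNr pairC. Qed.

Lemma pair0r D (f : vec D) : pair f 0 = 0.
Proof. by rewrite -[0](scale0r 0) pairZr mul0r. Qed.

Lemma pair_sumr D (f : vec D) (I : finType) (u : I -> vec D) :
  pair f (\sum_i u i) = \sum_i pair f (u i).
Proof.
apply: (big_ind2 (fun x y => pair f x = y)) => //; first exact: pair0r.
by move=> ? ? ? ? <- <-; rewrite pairDr.
Qed.

Lemma pair_mulmx r D (A : 'M[R]_(r, D)) f (y : vec r) :
  pair f (y *m A) = pair (f *m A^T) y.
Proof.
have: (pair f (y *m A))%:M = (pair (f *m A^T) y)%:M :> 'M_1.
  by rewrite -!pairE trmx_mul trmxK mulmxA.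
by move=> /rowP /(_ ord0); rewrite !mxE eqxx.
Qed.

Lemma shearE D (f w u : vec D) : u *m (1%:M - f^T *m w) = u - pair f u *: w.
Proof. by rewrite mulmxBr mulmx1 mulmxA pairE mul_scalar_mx. Qed.

Lemma shear_injective D (f w : vec D) : pair f w = 0 ->
  injective (fun u : vec D => u *m (1%:M - f^T *m w)).
Proof.
move=> fw x y; rewrite !shearE => e.
have ef : pair f x = pair f y.
  by have := congr1 (pair f) e; rewrite !pairDr !pairNr !pairZr fw !mulr0 subr0 subr0.
by move: e; rewrite ef => /addIr.
Qed.

(* The tropical map [phi_{w, F}] for the segment [F = conv (0, f)]. *)
Definition tropical D (f w u : vec D) : vec D := u - Num.min 0 (pair f u) *: w.

(** Moving along [w] does not change the value of [f], so the same multiple of [w] is restored. *)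
Lemma tropicalK D (f w : vec D) u : pair f w = 0 ->
  tropical f (- w) (tropical f w u) = u.
Proof.
move=> fw; rewrite /tropical pairDr pairNr pairZr fw mulr0 subr0.
by rewrite scalerN opprK subrK.
Qed.

(** * Hulls under the tropical map *)

Definition levels D (f : vec D) (S : region D) : Prop :=
  forall v, S v -> [\/ pair f v = -1, pair f v = 0 | pair f v = 1].

Definition exchange D (f : vec D) (S : region D) : Prop :=
  forall a b, S a -> S b -> pair f a = -1 -> pair f b = 1 ->
  exists c d, [/\ S c, S d, pair f c = 0, pair f d = 0 & a + b = c + d].

(** Both conditions are symmetric under [f -> - f], which lets [hull_ge0] also treat the half
    [f <= 0]. *)
Lemma levelsN D (f : vec D) S : levels f S -> levels (- f) S.
Proof.
move=> fS v /fS; rewrite pairNl => -[->|->|->].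
- by constructor 3; rewrite opprK.
- by constructor 2; rewrite oppr0.
- by constructor 1.
Qed.

Lemma exchangeN D (f : vec D) S : exchange f S -> exchange (- f) S.
Proof.
move=> fS a b Sa Sb; rewrite !pairNl => fa fb.
have [||c [d [Sc Sd fc fd e]]] := fS b a Sb Sa.
- by rewrite -fb opprK.
- by apply: oppr_inj; rewrite fa.
exists c, d; rewrite !pairNl fc fd oppr0; split=> //; by rewrite addrC.
Qed.

(* The weight on the level [-1] is cancelled against the level [1], which carries
   more weight, by exchanging each pair [a + b] for [c + d] in the level [0]. *)
Lemma hull_ge0 D (f : vec D) (S : region D) x : levels f S -> exchange f S ->
  hull S x -> 0 <= pair f x -> hull (fun y => S y /\ 0 <= pair f y) x.
Proof.
move=> fS fE [k [p [c [Sp c0 c1 ->]]]].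
pose S' y := S y /\ 0 <= pair f y.
pose N := [pred i | pair f (p i) == -1]; pose B := [pred i | pair f (p i) == 1].
pose Z := [pred i | pair f (p i) == 0].
have split3 (V : nmodType) (F : 'I_k -> V) :
    \sum_i F i = \sum_(i | Z i) F i + (\sum_(i | N i) F i + \sum_(i | B i) F i).
  rewrite (bigID Z) /=; congr (_ + _); rewrite (bigID N) /=; congr (_ + _); apply: eq_bigl => i.
    rewrite /Z /N /=; case: (fS _ (Sp i)) => ->; rewrite ?eqxx ?andbT ?andbF //.
    - by rewrite oppr_eq0 oner_eq0.
    - by rewrite eq_sym oppr_eq0 oner_eq0.
    - by rewrite oner_eq0.
  rewrite /Z /N /B /=; case: (fS _ (Sp i)) => ->; rewrite ?eqxx ?andbF //=.
  - by apply/esym/negbTE/eqP; lra.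
  - by apply/esym/negbTE/eqP; lra.
  - by apply/andP; split; apply/eqP; lra.
pose al := \sum_(i | N i) c i; pose be := \sum_(i | B i) c i.
rewrite pair_sumr split3 => fx.
(* Pairing the combination with [f] yields [be - al]. *)
have {fx} albe : al <= be.
  move: fx; rewrite big1 => [|i /eqP fi]; last by rewrite pairZr fi mulr0.
  rewrite (eq_bigr (fun i => - c i)) => [|i /eqP fi]; last by rewrite pairZr fi mulrN1.
  rewrite [X in _ + (_ + X)](eq_bigr c) => [|i /eqP fi]; last by rewrite pairZr fi mulr1.
  by rewrite sumrN add0r addrC subr_ge0.
have c0' i : c i \in Num.Def.nneg_num_pred by exact: c0.
have SZ i : Z i -> S' (p i) by move=> /eqP fi; rewrite /S' fi.
have SB i : B i -> S' (p i) by move=> /eqP fi; rewrite /S' fi ler01.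
apply/hullE; rewrite -c1 !split3; apply: combD.
  apply: comb_sum => i /SZ Si; rewrite -[X in comb _ _ X]mulr1; apply: combZ => //.
  exact: comb_mem.
have al0 : 0 <= al by apply: sumr_ge0.
(* This case is separate because the weights below divide by [be]; here [al <= be] forces all weight
   at level -1 to vanish. *)
have [be0|be0] := eqVneq be 0.
  have cN0 i : N i -> c i = 0.
    apply: (psumr_eq0P (fun i _ => c0 i)).
    by apply/eqP; rewrite -/al eq_le al0 andbT -be0.
  rewrite [X in comb _ _ (X + _)]big1 // [X in comb _ _ _ (X + _)]big1 ?add0r;
    last by move=> i /cN0 ->; rewrite scale0r.
  apply: comb_sum => i /SB Si; rewrite -[X in comb _ _ X]mulr1; apply: combZ => //.
  exact: comb_mem.
have be_gt0 : 0 < be by rewrite lt_def be0 (le_trans al0).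
(* The pair [(i, j)] receives weight [c i * c j / be]. Summed over [j] this exhausts [c i]; summed
   over [i] it uses [c j * al / be], leaving a nonnegative rest at level 1. *)
have -> : \sum_(i | N i) c i *: p i + \sum_(i | B i) c i *: p i =
    \sum_(i | N i) \sum_(j | B j) (c i * c j / be) *: (p i + p j) +
    \sum_(j | B j) (c j * (1 - al / be)) *: p j.
  under [X in _ = X + _]eq_bigr do under eq_bigr do rewrite scalerDr.
  under [X in _ = X + _]eq_bigr do rewrite big_split /=.
  rewrite big_split /= -addrA; congr (_ + _).
    apply: eq_bigr => i _; rewrite -scaler_suml -mulr_suml -mulr_sumr -/be.
    by rewrite mulfK.
  rewrite exchange_big -big_split /=; apply: eq_bigr => j _.
  rewrite -scaler_suml -mulr_suml -mulr_suml -/al -scalerDl; congr (_ *: _).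
  by field.
have -> : al + be = \sum_(i | N i) \sum_(j | B j) (c i * c j / be) * (1 + 1) +
    \sum_(j | B j) (c j * (1 - al / be)) * 1.
  under eq_bigr do rewrite -mulr_suml -mulr_suml -mulr_sumr -/be.
  rewrite -!mulr_suml -/al -/be.
  by field.
apply: combD.
  apply: comb_sum => i /eqP fi; apply: comb_sum => j /eqP fj; apply: combZ.
    by rewrite -topredE /= divr_ge0 ?mulr_ge0 // ltW.
  have [a [b [Sa Sb fa fb ->]]] := fE _ _ (Sp i) (Sp j) fi fj.
  by apply: combD; apply: comb_mem; rewrite /S' ?fa ?fb.
apply: comb_sum => j /SB Sj; apply: combZ; last exact: comb_mem.
by rewrite -topredE /= mulr_ge0 // subr_ge0 ler_pdivrMr // mul1r.
Qed.

(** The tropical map is the identity where [f >= 0] and a shear where [f <= 0]. Each half of the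
    hull is spanned by generators in that half, so the images of the generators suffice. *)
Lemma hull_tropical D (f w : vec D) (S S' : region D) u :
  levels f S -> exchange f S -> (forall v, S v -> S' (tropical f w v)) ->
  hull S u -> hull S' (tropical f w u).
Proof.
move=> fS fE SS' Su; case: (lerP 0 (pair f u)) => fu.
  rewrite /tropical min_l // scale0r subr0.
  apply: hull_sub (hull_ge0 fS fE Su fu) => y [/SS' Sy fy]; apply: hull_mem.
  by move: Sy; rewrite /tropical min_l // scale0r subr0.
rewrite /tropical min_r 1?ltW // -shearE.
have := hull_ge0 (levelsN fS) (exchangeN fE) Su.
rewrite pairNl oppr_ge0 => /(_ (ltW fu)) /hullE Su'.
set G := 1%:M - _.
pose T : region D := fun z => exists2 x, S x /\ 0 <= pair (- f) x & z = x *m G + 0.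
apply: (@hull_sub _ T).
  move=> y [x [/SS' Sx]]; rewrite pairNl oppr_ge0 => fx ->; apply: hull_mem.
  by move: Sx; rewrite /tropical min_r // addr0 shearE.
have TE z : T z <-> exists2 x, S x /\ 0 <= pair (- f) x & z = x *m G + 0 by [].
apply/hullE/(comb_affine_image _ _ _ TE).
by exists u; rewrite // scaler0 addr0.
Qed.

(** * Combinatorial mutations in lattice coordinates *)

Lemma zspan_int D (V : seq (vec D)) x : (forall v, v \in V -> isZvec v) ->
  zspan V x -> isZvec x.
Proof.
move=> VZ [k [p [c [Vp cZ _ ->]]]] j; rewrite summxE rpred_sum // => i _.
by rewrite mxE rpredM //; [exact: VZ].
Qed.

(** A linear form attains its minimum on a segment at an endpoint. *)
Lemma is_min_pair_segment D (f u : vec D) m :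
  is_min_pair (polytope [:: 0; f]) u m <-> m = Num.min 0 (pair f u).
Proof.
have min_le g : polytope [:: 0; f] g -> Num.min 0 (pair f u) <= pair g u.
  case=> k [p [c [Vp c0 c1 ->]]].
  rewrite [X in _ <= X]pairC pair_sumr -[X in X <= _]mul1r -[X in X * _]c1 mulr_suml.
  apply: ler_sum => i _; rewrite pairZr ler_wpM2l // [X in _ <= X]pairC.
  by have := Vp i; rewrite !inE => /orP[] /eqP ->;
    rewrite ge_min ?lexx ?orbT // [X in _ <= X]pairC pair0r lexx.
have attained : exists g, polytope [:: 0; f] g /\ pair g u = Num.min 0 (pair f u).
  case: (lerP 0 (pair f u)) => fu.
    by exists 0; split; [apply: hull_mem; rewrite inE eqxx|rewrite pairC pair0r].
  exists f; split=> //.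
  by apply: hull_mem; rewrite !inE eqxx orbT.
split=> [[[g [Fg <-]] gmin]|->]; last by split.
apply/le_anti; rewrite min_le // andbT.
by have [h [Fh <-]] := attained; exact: gmin.
Qed.

Lemma primitive_of_coord1 D (w : vec D) i : isZvec w -> w ord0 i = 1 -> primitive w.
Proof.
move=> wZ wi; split=> //.
  by apply/eqP => w0; move: wi; rewrite w0 mxE => /esym/eqP; rewrite oner_eq0.
move=> k w' /intrP[z ->] /(_ i) /intrP[t wt] wE; move: wi; rewrite wE mxE wt -intrM mulrC.
move=> /(@intr_inj _ _ 1) /intUnitRing.unitzPl /orP[] /eqP ->; [by left|by right; rewrite mulrN1z].
Qed.

Lemma polytope_chart r D (V : seq (vec D)) (A : 'M[R]_(r, D)) p0 g :
  injective (fun y : vec r => y *m A) -> (forall v, v \in V -> isZvec (g v)) ->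
  (forall v, v \in V -> g v *m A + p0 = v) -> V <> [::] ->
  lattice_polytope (fun y => polytope V (y *m A + p0)).
Proof.
move=> Ainj gZ gK V0; exists (map g V); split.
- by case: V V0 {gZ gK}.
- by move=> v /mapP[u Vu ->]; exact: gZ.
have VE z : z \in V <-> exists2 x, x \in map g V & z = x *m A + p0.
  split=> [Vz|[x /mapP[u Vu ->] ->]]; last by rewrite gK.
  by exists (g z); rewrite ?gK ?map_f.
move=> y; rewrite /polytope !hullE (comb_affine_image _ _ _ VE) scale1r.
split=> [[x Vx]|Vy]; last by exists y.
by move=> /(affine_injective Ainj) ->.
Qed.

(** The integer spans agree, so one chart serves both polytopes. It is centred at [p0], where [f]
    vanishes: the origin then lies in the first polytope and [f] becomes linear in the coordinates.
    The tropical map and its inverse give the two inclusions. *)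
Lemma exchange_step D (V W : seq (vec D)) (f w p0 a0 : vec D) i :
  zero_one V -> zero_one W -> isZvec f -> pair f w = 0 -> w ord0 i = 1 ->
  p0 \in V -> pair f p0 = 0 -> a0 \in V -> pair f a0 = -1 ->
  levels f (fun x => x \in V) -> levels f (fun x => x \in W) ->
  exchange f (fun x => x \in V) -> exchange f (fun x => x \in W) ->
  (forall v, v \in V -> tropical f w v \in W) ->
  (forall v, v \in W -> tropical f (- w) v \in V) ->
  (forall v, v \in V -> zspan W v) -> (forall v, v \in W -> zspan V v) ->
  mutation_step (polytope V) (polytope W).
Proof.
move=> V01 W01 fZ fw wi Vp0 fp0 Va0 fa0 fV fW eV eW VW WV VsW WsV.
have V0 : V <> [::] by move=> e; rewrite e in Vp0.
have W0 : W <> [::] by move=> e; have := VW _ Vp0; rewrite e.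
have [r [A [g [Ainj AZ gZ gK]]]] := zspan_chart (zero_one_int V01) Vp0.
have VWspan x : zspan V x <-> zspan W x by split; apply: zspan_mono.
(* The image of [a0] is [a0 + w], hence [p0 + w = p0 + (a0 + w) - a0] lies in the span. *)
have Ww : zspan V (p0 + w).
  have := WsV _ (VW _ Va0); rewrite /tropical fa0 min_r ?lerN10 // scaleN1r opprK.
  move=> Vaw; have := zspan_parallelogram (zspan_mem Vp0) Vaw (zspan_mem Va0).
  by rewrite addrCA addrAC addrA subrr add0r addrC.
pose w' := g (p0 + w); pose f' := f *m A^T.
have wA : w' *m A = w by have := gK _ Ww; rewrite addrC => /addrI.
have fE y : pair f (y *m A + p0) = pair f' y by rewrite pairDr fp0 addr0 pair_mulmx.
have fw' : pair f' w' = 0 by rewrite -pair_mulmx wA.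
have AZ' y : isZvec y -> isZvec (y *m A).
  move=> /AZ /(zspan_int (zero_one_int V01)) yZ j.
  have := rpredB (yZ j) (zero_one_int V01 Vp0 j); by rewrite mxE addrK.
have Z1 D' (x y : vec D') : isZvec x -> isZvec y -> pair x y \is a Num.int.
  by move=> xZ yZ; rewrite rpred_sum // => j _; rewrite rpredM.
have fZ' : isZvec f'.
  move=> j; have eZ : isZvec (delta_mx ord0 j : vec r).
    by move=> l; rewrite mxE; case: (_ && _); rewrite ?rpred0 ?rpred1.
  have := Z1 _ _ _ fZ (AZ' _ eZ); rewrite pair_mulmx -/f' /pair (bigD1 j) //=.
  rewrite [X in _ * X + _]mxE !eqxx mulr1 big1 ?addr0 // => l lj.
  by rewrite [X in _ * X]mxE (negPf lj) andbF mulr0.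
have wZ : isZvec w' := gZ _ Ww.
split; try exact: zero_one_lattice.
exists r, (fun y => polytope V (y *m A + p0)), (fun y => polytope W (y *m A + p0)); split.
- exists A, p0; split=> //; first exact: affine_injective.
    by move=> y /AZ Vy; apply/span_lattice_zero_one.
  move=> x /(span_lattice_zero_one _ V01) Vx; exists (g x); [exact: gZ|exact: gK].
- exists A, p0; split=> //; first exact: affine_injective.
    by move=> y /AZ /VWspan Vy; apply/span_lattice_zero_one.
  move=> x /(span_lattice_zero_one _ W01) /VWspan Vx; exists (g x); [exact: gZ|exact: gK].
constructor 2; split.
- by apply: (polytope_chart (g := g)) => // v /zspan_mem; [exact: gZ|exact: gK].
- by apply: hull_mem; rewrite mul0mx add0r.
exists w', (polytope [:: 0; f']); split.
- split=> //.
    by apply/eqP => w0; move: wi; rewrite -wA w0 mul0mx mxE => /esym/eqP; rewrite oner_eq0.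
  (* A factorisation of [w'] maps under [A] to one of [w], whose coordinate [i] is 1. *)
  move=> k u kZ uZ wE.
  have [_ _] := primitive_of_coord1 (AZ' _ wZ) (etrans (congr1 (fun x : vec D => x ord0 i) wA) wi).
  by move/(_ k (u *m A) kZ (AZ' _ uZ)); apply; rewrite wE scalemxAl.
- exists [:: 0; f']; split=> // v; rewrite !inE => /orP[] /eqP -> // j.
  by rewrite mxE rpred0.
- move=> h [k [p [c [Vp _ _ ->]]]]; rewrite pairC pair_sumr big1 // => j _.
  rewrite pairZr pairC; have := Vp j; rewrite !inE => /orP[] /eqP ->.
    by rewrite pairC pair0r mulr0.
  by rewrite fw' mulr0.
- move=> x; split=> [Wx|[u [m [Vu /is_min_pair_segment -> ->]]]].
    (* [f'] is constant along [w'], so the minimum at the preimage [x + m *: w'] is again [m]. *)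
    pose m := Num.min 0 (pair f' x).
    have xE : tropical f (- w) (x *m A + p0) = (x + m *: w') *m A + p0.
      by rewrite /tropical fE -/m scalerN opprK mulmxDl -scalemxAl wA addrAC.
    exists (x + m *: w'), m; split.
    + rewrite -xE; apply: hull_tropical Wx => //.
    + by apply/is_min_pair_segment; rewrite pairDr pairZr fw' mulr0 addr0.
    + by rewrite addrK.
  have -> : (u - Num.min 0 (pair f' u) *: w') *m A + p0 = tropical f w (u *m A + p0).
    by rewrite /tropical fE mulmxBl -scalemxAl wA addrAC.
  exact: hull_tropical Vu.
- move=> x y t Wx Wy t0 t1.
  have -> : (t *: x + (1 - t) *: y) *m A + p0 =
      t *: (x *m A + p0) + (1 - t) *: (y *m A + p0).
    rewrite mulmxDl -!scalemxAl !scalerDr addrACA -scalerDl [t + _]addrC subrK.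
    by rewrite scale1r.
  exact: hull_convex.
Qed.

(** * Vertices of matching field polytopes *)

Section MatchingFields.
Variable n : nat.
Implicit Types (i j p q k : 'I_n).

Definition unit_entry (a : 'I_3) j : vec (3 * n) := mxvec (delta_mx a j).

Definition vertex p q k : vec (3 * n) :=
  unit_entry 0 p + unit_entry 1 q + unit_entry (inord 2) k.

Definition vertices (P : nat -> nat -> nat -> bool) : seq (vec (3 * n)) :=
  [seq vertex t.1.1 t.1.2 t.2 | t : ('I_n * 'I_n * 'I_n)%type <- enum {: 'I_n * 'I_n * 'I_n}
                              & P t.1.1 t.1.2 t.2].

(* [sw i1 i2] tells whether the matching field sends [i1 < i2 < i3] to the
   transposition (12); the resulting vertices [vertex p q k] have one entry in
   column [p] of row 1, one in column [q] of row 2, one in column [k] of row 3. *)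
Definition admissible (sw : nat -> nat -> bool) (p q k : nat) : bool :=
  [&& p < q, q < k & ~~ sw p q]%N || [&& q < p, p < k & sw q p]%N.

Lemma verticesP P x :
  x \in vertices P <-> exists p q k, P p q k /\ x = vertex p q k.
Proof.
split=> [/mapP[[[p q] k]]|[p [q [k [Ppqk ->]]]]].
  by rewrite mem_filter => /andP[/= Ppqk _] ->; exists p, q, k.
apply/mapP; exists (p, q, k) => //; by rewrite mem_filter /= Ppqk mem_enum.
Qed.

Lemma inord2E : inord 2 = 2%:R :> 'I_3.
Proof. by apply: val_inj; rewrite /= inordK. Qed.

(** The three unit entries lie in different rows and never add up. *)
Lemma vertices01 P : zero_one (vertices P).
Proof.
move=> x /verticesP[p [q [k [_ ->]]]] l.
rewrite !mxE; case/mxvec_indexP: l => a j; rewrite !mxvecE !mxE.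
have [->|[->|->]] : a = 0 \/ a = 1 \/ a = inord 2.
  case: a => [[|[|[|//]]] h]; [left|right; left|right; right]; apply: val_inj => //=.
  by rewrite inordK.
- rewrite inord2E /= !addr0; case: (_ == _); by [right|left].
- rewrite inord2E /= addr0 add0r; case: (_ == _); by [right|left].
- rewrite inord2E /= !add0r; case: (_ == _); by [right|left].
Qed.

Lemma mf_vertex1 i j k : mxvec (mf_vertex 1 i j k) = vertex i j k.
Proof.
rewrite /vertex /unit_entry -!linearD /=; congr mxvec; apply/matrixP => a b.
rewrite !mxE !perm1; congr (_ + _); congr ((_ && _)%:R); congr (_ == _).
by apply: val_inj; rewrite /= inordK.
Qed.

Lemma mf_vertex_tperm i j k :
  mxvec (mf_vertex (tperm 0 1) i j k) = vertex j i k.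
Proof.
rewrite /vertex /unit_entry -!linearD /=; congr mxvec; apply/matrixP => a b.
rewrite !mxE tpermL tpermR tpermD // [in RHS](addrC ((_ && _)%:R)) inord2E.
by congr (_ + _).
Qed.

Lemma mf_polytopeE (sw : nat -> nat -> bool) (L : matching_field3 n) :
  (forall i j k, (i < j)%N -> (j < k)%N -> L i j k = if sw i j then tperm 0 1 else 1%g) ->
  mf_polytope L = polytope (vertices (admissible sw)).
Proof.
move=> LE; rewrite /mf_polytope /polytope; congr hull; apply/funext => x; apply/propext.
split=> [[i [j [k [ij jk ->]]]]|/verticesP[p [q [k [adm ->]]]]].
  have {}ij : (i < j)%N := ij; have {}jk : (j < k)%N := jk.
  rewrite LE //; case: ifP => s; apply/verticesP.
    by exists j, i, k; rewrite mf_vertex_tperm /admissible ij jk s orbT.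
  by exists i, j, k; rewrite mf_vertex1 /admissible ij jk s.
case/orP: adm => /and3P[h1 h2 s].
  by exists p, q, k; split=> //; rewrite LE // (negPf s) mf_vertex1.
by exists q, p, k; split=> //; rewrite LE // s mf_vertex_tperm.
Qed.

(* After the columns 1 and 2 of [B_1] are exchanged, [swap_upto m] makes the
   field differ from [B_2] only at the sets [{1, i, j}] with [m < i] (1-based). *)
Definition swap_upto (m i1 i2 : nat) : bool :=
  [&& i1 < 2, 2 <= i2 & (i1 == 1) || (i2 < m)]%N.

Definition chain_vertices m := vertices (admissible (swap_upto m)).

Variables (o0 o1 : 'I_n).
Hypotheses (o0E : nat_of_ord o0 = 0%N) (o1E : nat_of_ord o1 = 1%N).

(** * Exchange of the first two columns *)

Lemma swap_columns_step : (2 < n)%N ->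
  mutation_step (polytope (vertices (admissible (fun i _ : nat => i == 0%N))))
    (polytope (chain_vertices 2)).
Proof.
move=> n3; pose s := tperm o0 o1; pose G : 'M[R]_(3 * n) := lin_mulmxr (perm_mx s).
have entryG a j : unit_entry a j *m G = unit_entry a (s j).
  rewrite /unit_entry /G /lin_mulmxr mul_vec_lin /=; congr mxvec.
  rewrite -[perm_mx s]/(tperm_mx o0 o1) -xcolE; apply/matrixP => b l; rewrite !mxE.
  by rewrite (can2_eq (tpermK o0 o1) (tpermK o0 o1)).
have vertexG p q k : vertex p q k *m G = vertex (s p) (s q) (s k).
  by rewrite /vertex !mulmxDl !entryG.
have GG (x : vec (3 * n)) : x *m G *m G = x.
  rewrite -[x]vec_mxK /G /lin_mulmxr !mul_vec_lin /=; congr mxvec.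
  by rewrite -mulmxA -perm_mxM tperm2 perm_mx1 mulmx1.
have sE j : nat_of_ord (s j) =
    (if nat_of_ord j == 0 then 1 else if nat_of_ord j == 1 then 0 else nat_of_ord j)%N.
  rewrite /s; case: tpermP => [->|->|]; rewrite ?o0E ?o1E //.
  move=> /eqP; rewrite -val_eqE /= o0E => /negPf -> /eqP.
  by rewrite -val_eqE /= o1E => /negPf ->.
have admE p q k : admissible (fun i _ : nat => i == 0%N) (s p) (s q) (s k) =
    admissible (swap_upto 2) p q k.
  rewrite !sE /admissible /swap_upto.
  case: (nat_of_ord p) => [|[|p']]; case: (nat_of_ord q) => [|[|q']];
    case: (nat_of_ord k) => [|[|k']] /=; lia.
apply: (linear_step (G := G)).
- have: vertex o1 o0 (Ordinal n3) \in vertices (admissible (fun i _ : nat => i == 0%N)).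
    apply/verticesP; exists o1, o0, (Ordinal n3); split=> //.
    by rewrite /admissible o0E o1E.
  by move=> + e; rewrite e.
- exact: vertices01.
- exact: vertices01.
- by move=> x y /(congr1 (fun u => u *m G)); rewrite !GG.
- move=> x; split=> [/verticesP[p [q [k [adm ->]]]]|[y /verticesP[p [q [k [adm ->]]]] ->]].
    exists (vertex (s p) (s q) (s k)); last by rewrite vertexG !tpermK.
    by apply/verticesP; exists (s p), (s q), (s k); rewrite admE.
  rewrite vertexG; apply/verticesP; exists (s p), (s q), (s k); split=> //.
  by rewrite -admE !tpermK.
Qed.

(** * The functional and the direction of step [m] *)

Variable m : 'I_n.
Hypotheses (m_ge2 : (2 <= m)%N) (m_lt : (m.+1 < n)%N).

(** The first row charges -1 outside the columns [2 <= j < m]; the second adds 1 at column 1 and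
    beyond [m]. Among admissible pairs the total is -1 only at [(0, m)] before the step and at
    [(m, 0)] after it. *)
Definition functional : vec (3 * n) :=
  mxvec (\matrix_(a < 3, j < n)
    (if a == 0 then - (~~ (2 <= j < m)%N)%:R
     else if a == 1 then ((nat_of_ord j == 1%N) || (m < j)%N)%:R else 0)).

Definition direction : vec (3 * n) :=
  unit_entry 1 o0 + unit_entry 0 m - unit_entry 0 o0 - unit_entry 1 m.

Definition level (p q : nat) : R :=
  ((q == 1%N) || (m < q)%N)%:R - (~~ (2 <= p < m)%N)%:R.

Lemma pair_functional a j : pair functional (unit_entry a j) =
  if a == 0 then - (~~ (2 <= j < m)%N)%:R
  else if a == 1 then ((nat_of_ord j == 1%N) || (m < j)%N)%:R else 0.
Proof.
rewrite /unit_entry mxvec_delta /pair (bigD1 (mxvec_index a j)) //=.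
rewrite [X in _ * X + _]mxE !eqxx mulr1 big1 ?addr0; first by rewrite mxvecE mxE.
by move=> l lj; rewrite [X in _ * X]mxE (negPf lj) andbF mulr0.
Qed.

Lemma pair_vertex p q k : pair functional (vertex p q k) = level p q.
Proof. by rewrite !pairDr !pair_functional inord2E /= addr0 addrC. Qed.

Lemma pair_direction : pair functional direction = 0.
Proof.
have e1 : (2 <= m < m)%N = false by lia.
have e2 : (nat_of_ord m == 1%N) || (m < m)%N = false by lia.
rewrite !(pairDr, pairNr) !pair_functional /= o0E e1 e2 /=.
by ring.
Qed.

Lemma functional_int : isZvec functional.
Proof.
move=> l; case/mxvec_indexP: l => a j; rewrite mxvecE mxE.
by case: ifP => _; [rewrite rpredN|case: ifP => _]; rewrite ?rpred_nat ?rpred0.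
Qed.

Lemma direction_coord : direction ord0 (mxvec_index 1 o0) = 1.
Proof.
rewrite /direction /unit_entry !mxE !mxvecE !mxE /= eqxx.
have /negPf -> : o0 != m by rewrite -val_eqE /= o0E; lia.
by rewrite !subr0 addr0.
Qed.

Lemma level_cases (p q : nat) :
  [\/ level p q = -1, level p q = 0 | level p q = 1].
Proof.
rewrite /level; case: (_ || _); case: (~~ _); rewrite ?subrr ?subr0 ?sub0r.
- by constructor 2.
- by constructor 3.
- by constructor 1.
- by constructor 2.
Qed.

Lemma level_eqN1 (p q : nat) :
  level p q = -1 -> [&& q != 1%N, (q <= m)%N & ~~ (2 <= p < m)%N].
Proof.
rewrite /level [(q <= m)%N]leqNgt andbA -negb_or.
by case: (_ || _); case: (~~ _) => //= e; exfalso; lra.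
Qed.

Lemma level_eq1 (p q : nat) :
  level p q = 1 -> ((q == 1%N) || (m < q)%N) && (2 <= p < m)%N.
Proof.
rewrite /level; case: (_ || _); case: (_ && _) => //= e; exfalso; lra.
Qed.

Lemma level_eq0 (p q : nat) :
  ((q == 1%N) || (m < q)%N) = ~~ (2 <= p < m)%N -> level p q = 0.
Proof. by rewrite /level => ->; rewrite subrr. Qed.

Lemma levels_vertices P : levels functional (fun x => x \in vertices P).
Proof.
by move=> x /verticesP[p [q [k [_ ->]]]]; rewrite pair_vertex; apply: level_cases.
Qed.

Lemma admissible_level_N1 p q k : admissible (swap_upto m) p q k -> level p q = -1 ->
  p = o0 /\ q = m.
Proof.
move=> adm /level_eqN1 h; move: adm; rewrite /admissible /swap_upto => adm.
by split; apply: val_inj; rewrite /= ?o0E; lia.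
Qed.

Lemma admissibleS_level_N1 p q k : admissible (swap_upto m.+1) p q k -> level p q = -1 ->
  p = m /\ q = o0.
Proof.
move=> adm /level_eqN1 h; move: adm; rewrite /admissible /swap_upto => adm.
by split; apply: val_inj; rewrite /= ?o0E; lia.
Qed.

(** The two fields differ only at the columns 0 and [m], and both orders of this pair have level
    -1. *)
Lemma admissible_level_ge0 (p q k : nat) : level p q != -1 ->
  admissible (swap_upto m) p q k = admissible (swap_upto m.+1) p q k.
Proof.
move=> h; have {}h : ~~ [&& q != 1%N, (q <= m)%N & ~~ (2 <= p < m)%N].
  apply: contra h; rewrite leqNgt andbA -negb_or /level => /andP[/negPf -> ->].
  by rewrite sub0r.
by move: h; rewrite /admissible /swap_upto; lia.
Qed.

Lemma vertex_chain p q k (l : nat) :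
  admissible (swap_upto l) p q k -> vertex p q k \in chain_vertices l.
Proof. by move=> adm; apply/verticesP; exists p, q, k. Qed.

Lemma level_o0_m : level o0 m = -1.
Proof.
rewrite /level o0E ltnn orbF; have /negPf -> : nat_of_ord m != 1%N by lia.
by rewrite /= sub0r.
Qed.

Lemma tropical_vertex_N1 k : tropical functional direction (vertex o0 m k) = vertex m o0 k.
Proof.
rewrite /tropical pair_vertex level_o0_m min_r ?lerN10 // /vertex /direction /unit_entry.
by apply/rowP => l; rewrite !mxE; ring.
Qed.

Lemma tropical_vertex_ge0 w p q k : level p q != -1 ->
  tropical functional w (vertex p q k) = vertex p q k.
Proof.
rewrite /tropical pair_vertex.
by case: (level_cases p q) => ->; rewrite ?eqxx // min_l ?scale0r ?subr0.
Qed.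

Lemma tropical_chain v :
  v \in chain_vertices m -> tropical functional direction v \in chain_vertices m.+1.
Proof.
move=> /verticesP[p [q [k [adm ->]]]]; have [lE|lN] := eqVneq (level p q) (-1).
  have [? ?] := admissible_level_N1 adm lE; subst p q.
  rewrite tropical_vertex_N1; apply: vertex_chain.
  by move: adm; rewrite /admissible /swap_upto o0E; lia.
by rewrite tropical_vertex_ge0 //; apply: vertex_chain; rewrite -admissible_level_ge0.
Qed.

Lemma tropicalN_chain v :
  v \in chain_vertices m.+1 -> tropical functional (- direction) v \in chain_vertices m.
Proof.
move=> /verticesP[p [q [k [adm ->]]]]; have [lE|lN] := eqVneq (level p q) (-1).
  have [? ?] := admissibleS_level_N1 adm lE; subst p q.
  rewrite -tropical_vertex_N1 tropicalK ?pair_direction //; apply: vertex_chain.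
  by move: adm; rewrite /admissible /swap_upto o0E; lia.
by rewrite tropical_vertex_ge0 //; apply: vertex_chain; rewrite admissible_level_ge0.
Qed.

(** * Exchanges and spanned lattices of consecutive fields *)

(** The two vertices trade their columns in the first row. Each third column stays with its
    second-row column, which it exceeds. *)
Lemma exchange_chain : exchange functional (fun x => x \in chain_vertices m).
Proof.
move=> a b /verticesP[p [q [k [adm ->]]]] /verticesP[p' [q' [k' [adm' ->]]]].
rewrite !pair_vertex => lE /level_eq1 lE'.
have [? ?] := admissible_level_N1 adm lE; subst p q.
move: adm adm'; rewrite /admissible /swap_upto o0E => adm adm'.
exists (vertex o0 q' k'), (vertex p' m k); rewrite !pair_vertex; split.
- by apply: vertex_chain; rewrite /admissible /swap_upto o0E; lia.
- by apply: vertex_chain; rewrite /admissible /swap_upto; lia.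
- by apply: level_eq0; rewrite o0E; lia.
- by apply: level_eq0; lia.
- by apply/rowP => l; rewrite /vertex /unit_entry !mxE; ring.
Qed.

Lemma exchange_chainS : exchange functional (fun x => x \in chain_vertices m.+1).
Proof.
move=> a b /verticesP[p [q [k [adm ->]]]] /verticesP[p' [q' [k' [adm' ->]]]].
rewrite !pair_vertex => lE /level_eq1 lE'.
have [? ?] := admissibleS_level_N1 adm lE; subst p q.
move: adm adm'; rewrite /admissible /swap_upto o0E => adm adm'.
(* If [q'] is column 1, then [k'] may fail to exceed [m], so [m] keeps [k]. If [q'] is beyond [m],
   then [k] may fail to exceed [q'], so [q'] keeps [k']. *)
have [q1|q1] := eqVneq (nat_of_ord q') 1%N.
  exists (vertex m q' k), (vertex p' o0 k'); rewrite !pair_vertex; split.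
  - by apply: vertex_chain; rewrite /admissible /swap_upto; lia.
  - by apply: vertex_chain; rewrite /admissible /swap_upto o0E; lia.
  - by apply: level_eq0; lia.
  - by apply: level_eq0; rewrite o0E; lia.
  - by apply/rowP => l; rewrite /vertex /unit_entry !mxE; ring.
exists (vertex m q' k'), (vertex p' o0 k); rewrite !pair_vertex; split.
- by apply: vertex_chain; rewrite /admissible /swap_upto; lia.
- by apply: vertex_chain; rewrite /admissible /swap_upto o0E; lia.
- by apply: level_eq0; lia.
- by apply: level_eq0; rewrite o0E; lia.
- by apply/rowP => l; rewrite /vertex /unit_entry !mxE; ring.
Qed.

(** A vertex at level -1 is the fourth corner of a parallelogram whose other corners belong to both
    fields. The bound [2 < m] supplies the column [o2] strictly between 1 and [m]. *)
Lemma zspan_chain v : (2 < m)%N -> v \in chain_vertices m -> zspan (chain_vertices m.+1) v.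
Proof.
move=> m3 /verticesP[p [q [k [adm ->]]]]; have [lE|lN] := eqVneq (level p q) (-1); last first.
  by apply/zspan_mem/vertex_chain; rewrite -admissible_level_ge0.
have [? ?] := admissible_level_N1 adm lE; subst p q.
pose o2 := Ordinal (ltn_trans m3 (ltn_ord m)).
have -> : vertex o0 m k = vertex o0 o1 k + vertex o2 m k - vertex o2 o1 k.
  by apply/rowP => l; rewrite /vertex /unit_entry !mxE; ring.
move: adm; rewrite /admissible /swap_upto o0E => adm.
by apply: zspan_parallelogram; apply/zspan_mem/vertex_chain;
  rewrite /admissible /swap_upto ?o0E ?o1E /=; lia.
Qed.

Lemma zspan_chainS v : (2 < m)%N -> v \in chain_vertices m.+1 -> zspan (chain_vertices m) v.
Proof.
move=> m3 /verticesP[p [q [k [adm ->]]]]; have [lE|lN] := eqVneq (level p q) (-1); last first.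
  by apply/zspan_mem/vertex_chain; rewrite admissible_level_ge0.
have [? ?] := admissibleS_level_N1 adm lE; subst p q.
pose o2 := Ordinal (ltn_trans m3 (ltn_ord m)).
have -> : vertex m o0 k = vertex m o1 k + vertex o2 o0 k - vertex o2 o1 k.
  by apply/rowP => l; rewrite /vertex /unit_entry !mxE; ring.
move: adm; rewrite /admissible /swap_upto o0E => adm.
by apply: zspan_parallelogram; apply/zspan_mem/vertex_chain;
  rewrite /admissible /swap_upto ?o0E ?o1E /=; lia.
Qed.

(** The column [m.+1] completes both pairs. The vertices provide a point at level -1 and a base
    point at level 0. *)
Lemma vertex_max_in :
  {k | vertex o0 m k \in chain_vertices m & vertex o0 o1 k \in chain_vertices m}.
Proof.
by exists (Ordinal m_lt); apply: vertex_chain;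
  rewrite /admissible /swap_upto o0E ?o1E /=; lia.
Qed.

Lemma chain_mutation_step : (2 < m)%N ->
  mutation_step (polytope (chain_vertices m)) (polytope (chain_vertices m.+1)).
Proof.
move=> m3; have [k Pa Pc] := vertex_max_in.
apply: (@exchange_step _ _ _ functional direction (vertex o0 o1 k)
  (vertex o0 m k) (mxvec_index 1 o0)).
- exact: vertices01.
- exact: vertices01.
- exact: functional_int.
- exact: pair_direction.
- exact: direction_coord.
- exact: Pc.
- by rewrite pair_vertex; apply: level_eq0; rewrite o0E o1E.
- exact: Pa.
- by rewrite pair_vertex level_o0_m.
- exact: levels_vertices.
- exact: levels_vertices.
- exact: exchange_chain.
- exact: exchange_chainS.
- exact: tropical_chain.
- exact: tropicalN_chain.
- by move=> v; apply: zspan_chain.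
- by move=> v; apply: zspan_chainS.
Qed.

(* For [m = 2] the functional is nonpositive on both polytopes, so that the
   tropical map is a shear; the affine hulls differ here. *)
Lemma chain_shear_step : nat_of_ord m = 2%N ->
  mutation_step (polytope (chain_vertices m)) (polytope (chain_vertices m.+1)).
Proof.
move=> m2.
have shear w x l : x \in chain_vertices l -> tropical functional w x = x - pair functional x *: w.
  move=> /verticesP[p [q [k [adm ->]]]]; rewrite /tropical; congr (_ - _ *: _).
  rewrite pair_vertex; apply: min_r; case: (level_cases p q) => [->|->|/level_eq1].
  - by rewrite lerN10.
  - by [].
  - by lia.
apply: (linear_step (G := 1%:M - functional^T *m direction)).
- have [k Pa _] := vertex_max_in; by move=> e; rewrite e in Pa.
- exact: vertices01.
- exact: vertices01.
- exact/shear_injective/pair_direction.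
- move=> z; split=> [Pz|[x Px ->]]; last by rewrite shearE -(shear _ _ _ Px); exact: tropical_chain.
  exists (tropical functional (- direction) z); first exact: tropicalN_chain.
  rewrite shearE -(shear _ _ _ (tropicalN_chain Pz)).
  have := @tropicalK _ functional (- direction) z.
  by rewrite opprK => -> //; rewrite pairNr pair_direction oppr0.
Qed.

End MatchingFields.

(** * Assembly of the chain *)

Lemma mutation_seq_swap_upto (n : nat) (o0 o1 : 'I_n) (d m : nat) :
  nat_of_ord o0 = 0%N -> nat_of_ord o1 = 1%N -> (2 <= m)%N -> (m + d).+1 = n ->
  mutation_seq (polytope (chain_vertices n m)) (polytope (chain_vertices n n.-1)).
Proof.
move=> o0E o1E; elim: d m => [|d IHd] m m2 mn.
  rewrite addn0 in mn; rewrite -mn; exact: mseq_refl.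
have mlt : (m.+1 < n)%N by lia.
pose om := Ordinal (ltnW mlt).
apply: (@mseq_step _ _ _ _ (polytope (chain_vertices n m.+1))); last by apply: IHd; lia.
have [mE|mN] := eqVneq m 2%N; first exact: (@chain_shear_step n o0 o1 o0E o1E om m2 mlt mE).
by apply: (@chain_mutation_step n o0 o1 o0E o1E om m2 mlt); rewrite /=; lia.
Qed.

Theorem theorem3p5 (n : nat) (hn : (3 <= n)%N) :
  mutation_seq (mf_polytope (block_diag n 1)) (mf_polytope (block_diag n 2)).
Proof.
have n2 : (1 < n)%N by lia.
pose o0 : 'I_n := Ordinal (ltnW n2); pose o1 : 'I_n := Ordinal n2.
rewrite (@mf_polytopeE n (fun i _ => i == 0%N)); last first.
  move=> i j k ij jk; rewrite /block_diag; congr (if _ then _ else _).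
  have -> : ltn j 1 = false by rewrite /=; lia.
  have -> : ltn k 1 = false by rewrite /=; lia.
  by case: (nat_of_ord i).
(* A middle index is below the largest one, hence below [n.-1], so at this stage every required
   transposition has been made. *)
rewrite (@mf_polytopeE n (swap_upto n.-1)); last first.
  move=> i j k ij jk; rewrite /block_diag; congr (if _ then _ else _).
  have -> : ltn k 2 = false by rewrite /=; lia.
  have jn : (j < n.-1)%N by have := ltn_ord k; lia.
  rewrite /swap_upto jn orbT andbT /=.
  by case: (ltnP i 2) => i2; case: (ltnP j 2) => j2 //; lia.
apply: (mseq_step (@swap_columns_step n o0 o1 erefl erefl hn)).
by apply: (@mutation_seq_swap_upto n o0 o1 (n - 3)) => //; lia.
Qed.
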